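(* A Lie group $G$ with a two-dimensional commutator subgroup does not admit a bi-invariant Riemannian metric.
   Context: Lie groups are real, finite-dimensional and connected; the commutator subgroup of $G$ being two-dimensional means that $[\mathfrak g,\mathfrak g]$ has dimension $2$, where $\mathfrak g$ is the Lie algebra of $G$. A Riemannian metric on $G$ is bi-invariant if it is invariant under all left and right translations; for a left-invariant metric $\langle\cdot,\cdot\rangle$ on connected $G$ this means $\langle X,[Y,Z]\rangle=\langle[X,Y],Z\rangle$ for all $X,Y,Z\in\mathfrak g$. *)

(* Defs.v *)
From HB Require Import structures.
From mathcomp Require Import all_boot all_order all_algebra.
From mathcomp Require Import all_classical all_reals all_analysis.

Set Implicit Arguments.
Unset Strict Implicit.
Unset Printing Implicit Defensive.

Import Order.TTheory GRing.Theory Num.Theory.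
Import numFieldNormedType.Exports.

Local Open Scope classical_set_scope.
Local Open Scope ring_scope.

Section Smooth.
Context {R : realType} {V W : normedModType R}.

(* Meant for an open set U and a finite-dimensional V: then f is C^(k+1) on U
   iff it is differentiable there and all its directional derivatives
   x |-> 'd f x v are C^k. *)
Fixpoint Ck (k : nat) (U : set V) (f : V -> W) : Prop :=
  if k is k'.+1 then
    (forall x, U x -> differentiable f x) /\
    (forall v, Ck k' U (fun x => 'd f x v))
  else forall x, U x -> {for x, continuous f}.

Definition smooth_on (U : set V) (f : V -> W) : Prop := forall k, Ck k U f.

End Smooth.

Section LinearSpan.
Context {R : realType} {V : lmodType R}.

Definition linear_span (S : set V) : set V :=
  [set v | exists (k : nat) (a : 'I_k -> R) (b : 'I_k -> V),
     (forall i, S (b i)) /\ v = \sum_(i < k) a i *: b i].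

Definition has_dimension (S : set V) (d : nat) : Prop :=
  exists b : 'I_d -> V,
    (forall a : 'I_d -> R,
       \sum_(i < d) a i *: b i = 0 -> forall i, a i = 0) /\
    S = linear_span (range b).

End LinearSpan.

(* A homeomorphism between an open subset of M and an open subset of R^n; the
   values of [to_coord] outside [dom] and of [of_coord] outside [cod] are
   irrelevant. *)
Record chart (R : realType) (n : nat) (M : topologicalType) := Chart {
  dom : set M;
  cod : set 'rV[R]_n;
  to_coord :> M -> 'rV[R]_n;
  of_coord : 'rV[R]_n -> M;
  dom_open : open dom;
  cod_open : open cod;
  to_coord_cod : forall p, dom p -> cod (to_coord p);
  of_coord_dom : forall x, cod x -> dom (of_coord x);
  to_coordK : forall p, dom p -> of_coord (to_coord p) = p;
  of_coordK : forall x, cod x -> to_coord (of_coord x) = x;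
  to_coord_continuous : forall p, dom p -> {for p, continuous to_coord};
  of_coord_continuous : forall x, cod x -> {for x, continuous of_coord}
}.

(* An n-dimensional smooth manifold, given by a smooth atlas (not required to
   be maximal). [chart_at p] is a distinguished chart around p; it only serves
   to identify the tangent space T_p M with R^n. *)
HB.mixin Record Topological_isManifold (R : realType) (n : nat) M
    of Topological M := {
  atlas : set (chart R n M);
  chart_at : M -> chart R n M;
  chart_at_atlas : forall p, atlas (chart_at p);
  chart_at_dom : forall p, dom (chart_at p) p;
  atlas_compatible : forall c d, atlas c -> atlas d ->
    smooth_on [set x | cod c x /\ dom d (of_coord c x)]
              (fun x => d (of_coord c x));
  manifold_hausdorff : hausdorff_space M;
  manifold_second_countable : @second_countable M
}.

#[short(type="manifoldType")]
HB.structure Definition Manifold (R : realType) (n : nat) :=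
  {M of Topological M & Topological_isManifold R n M}.

Arguments atlas {R n} M : rename.
Arguments chart_at {R n M} p : rename.

HB.mixin Record Manifold_isLieGroup (R : realType) (n : nat) G
    of Manifold R n G & Group G := {
  mulg_continuous : continuous (fun pq : G * G => (pq.1 * pq.2)%g);
  mulg_smooth : forall a b c : chart R n G,
    atlas G a -> atlas G b -> atlas G c ->
    smooth_on [set x : 'rV[R]_n * 'rV[R]_n |
                 [/\ cod a x.1, cod b x.2 &
                     dom c (of_coord a x.1 * of_coord b x.2)%g]]
              (fun x => c (of_coord a x.1 * of_coord b x.2)%g);
  invg_continuous : continuous (fun p : G => p^-1%g);
  invg_smooth : forall a c : chart R n G, atlas G a -> atlas G c ->
    smooth_on [set x | cod a x /\ dom c (of_coord a x)^-1%g]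
              (fun x => c (of_coord a x)^-1%g)
}.

#[short(type="lieGroupType")]
HB.structure Definition LieGroup (R : realType) (n : nat) :=
  {G of Manifold R n G & Group G & Manifold_isLieGroup R n G}.

Section Tangent.
Context {R : realType} {n : nat} {M : manifoldType R n}.

(* A tangent vector at p is represented by its coordinates v : 'rV[R]_n with
   respect to [chart_at p]; a vector field (a section of T M) is thus a
   function M -> 'rV[R]_n, and the linear structure of T_p M, hence of the
   space of vector fields, is the pointwise one. *)

Definition tangent_map (F : M -> M) (p : M) : 'rV[R]_n -> 'rV[R]_n :=
  'd (fun x => chart_at (F p) (F (of_coord (chart_at p) x))) (chart_at p p).

(* The coordinates with respect to c of the tangent vector v at p. *)
Definition tangent_to_coord (c : chart R n M) (p : M) :
    'rV[R]_n -> 'rV[R]_n :=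
  'd (fun x => c (of_coord (chart_at p) x)) (chart_at p p).

(* The tangent vector at p whose coordinates with respect to c are u. *)
Definition tangent_of_coord (c : chart R n M) (p : M) :
    'rV[R]_n -> 'rV[R]_n :=
  'd (fun x => chart_at p (of_coord c x)) (c p).

Definition field_in_coord (c : chart R n M) (X : M -> 'rV[R]_n) :
    'rV[R]_n -> 'rV[R]_n :=
  fun x => tangent_to_coord c (of_coord c x) (X (of_coord c x)).

Definition smooth_field (X : M -> 'rV[R]_n) : Prop :=
  forall c, atlas M c -> smooth_on (cod c) (field_in_coord c X).

(* [X, Y] = DY(X) - DX(Y) in local coordinates, computed at p in the chart
   [chart_at p]. *)
Definition lie_bracket (X Y : M -> 'rV[R]_n) : M -> 'rV[R]_n := fun p =>
  let c := chart_at p in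
  let X' := field_in_coord c X in
  let Y' := field_in_coord c Y in
  'd Y' (c p) (X' (c p)) - 'd X' (c p) (Y' (c p)).

(* The last clause says that the components of g in local coordinates are
   smooth functions. *)
Definition riemannian_metric (g : M -> 'rV[R]_n -> 'rV[R]_n -> R) : Prop :=
  [/\ forall p v, scalar (g p v),
      forall p v w, g p v w = g p w v,
      forall p v, v != 0 -> 0 < g p v v &
      forall c u w, atlas M c ->
        smooth_on (cod c) (fun x =>
          let p := of_coord c x in
          g p (tangent_of_coord c p u) (tangent_of_coord c p w) : R^o)].

Definition metric_isometry (g : M -> 'rV[R]_n -> 'rV[R]_n -> R)
    (F : M -> M) : Prop :=
  forall p v w, g (F p) (tangent_map F p v) (tangent_map F p w) = g p v w.

End Tangent.

Section LieAlgebra.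
Context {R : realType} {n : nat}.
Variable G : lieGroupType R n.

Definition left_invariant (X : G -> 'rV[R]_n) : Prop :=
  forall h p : G, tangent_map (fun q => (h * q)%g) p (X p) = X (h * p)%g.

Definition lie_algebra : set (G -> 'rV[R]_n) :=
  [set X | smooth_field X /\ left_invariant X].

(* The ideal [g, g] of the Lie algebra g of G. *)
Definition commutator_algebra : set (G -> 'rV[R]_n) :=
  linear_span [set Z | exists X Y, [/\ lie_algebra X, lie_algebra Y &
                                       Z = lie_bracket X Y]].

Definition bi_invariant (g : G -> 'rV[R]_n -> 'rV[R]_n -> R) : Prop :=
  forall h : G, metric_isometry g (fun q => (h * q)%g) /\
                metric_isometry g (fun q => (q * h)%g).

End LieAlgebra.

Arguments lie_algebra {R n} G.
Arguments commutator_algebra {R n} G.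

(* Main.v *)
From HB Require Import structures.
Require Import Defs.
From mathcomp Require Import all_boot all_order all_algebra.
From mathcomp Require Import all_classical all_reals all_analysis.
From mathcomp Require Import ring lra.

(** A bi-invariant metric [g] makes every [ad W] skew-symmetric, so that
    [g ([X, Y], Z)] is an alternating trilinear form on the Lie algebra; and an
    alternating form leaves no room for a two-dimensional derived algebra.
    Indeed, let [b0], [b1] span the values of all brackets.  The bracket
    [[b0, b1]] is orthogonal to [b0] and [b1] while lying in their span, hence
    it is 0.  So the derived algebra is abelian, and then for [y] in it and any
    [W] the bracket [[W, y]] is orthogonal to [b0] and [b1], hence 0, whence
    [y = [U, V]] satisfies [g (y, y) = g ([V, y], U) = 0].  All brackets vanish,
    and the derived algebra has dimension 0.  This is
    [skew_bracket_plane_eq0]; it is applied to the values of left-invariant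
    fields at each point separately, and the brackets vanish as fields because
    they vanish at every point.

    The skew-symmetry ([bracket_skew]) is obtained without exponentials or
    flows.  Write the product in charts as [m (x, y)], with [x] near a point
    [p] and [y] near [1], and let [q] be the point with coordinates
    [m (p, y)].  Two vectors at [q] have the same length: the value at [q] of
    the left-invariant field [U], with coordinates [D_2 m (q, 1) (U 1)], because
    left translations are isometries, and the right translate to [q] of
    [U p], with coordinates [D_1 m (p, y) (U p)], because right translations
    are ([curves_same_norm]).  Both equal [U p] at [y = 1].  Hence the metric
    vanishes on (difference, sum) of the two curves; dividing by the parameter
    and passing to the limit shows that the derivative of the difference is
    orthogonal to [2 U p].  By the symmetry of second derivatives ([schwarz])
    this derivative, in the direction of [W], is [[W, U] p]
    ([curve_diff_bracket]).

    Every left-invariant field is determined by its value at the identity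
    ([left_field_eq]), and conversely every vector there extends to a smooth
    left-invariant field, smooth because its coordinates are partial derivatives
    of [m] ([left_field_coordE]); so the Lie algebra has an element with any
    prescribed value at any point. *)

Set Implicit Arguments.
Unset Strict Implicit.
Unset Printing Implicit Defensive.

Import Order.TTheory GRing.Theory Num.Theory.
Import numFieldNormedType.Exports.

Local Open Scope classical_set_scope.
Local Open Scope ring_scope.

(** * Differentials and the symmetry of second derivatives *)

Section Germs.
Context {R : realType} {V W : normedModType R}.

(** Coordinate changes cancel only inside chart domains, so their
    differentials are computed from functions that agree with them only near the
    point. *)
Lemma diff_near_eq (f g : V -> W) (x : V) :
    (\forall y \near x, f y = g y) -> differentiable f x ->
  differentiable g x /\ 'd g x = 'd f x :> (V -> W).
Proof.
move=> fg df; have fgx := nbhs_singleton fg.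
have gE : g \o shift x = cst (g x) + 'd f x +o_ 0 id.
  have /eqaddoP df' := diff_locally df.
  apply/eqaddoP => e e0; have := df' e e0.
  have fg0 : \forall y \near 0, f (y + x) = g (y + x).
    by move: fg; rewrite (near_shift 0) subr0.
  move: fg0; apply: filterS2 => y fgy.
  by rewrite /= !fctE /= /cst -fgx -fgy.
have dgE : 'd g x = 'd f x :> (V -> W).
  by apply: diff_unique gE; exact: diff_continuous.
by split=> //; apply/diff_locallyP; rewrite dgE; split=> //; exact: diff_continuous.
Qed.

End Germs.

Section Schwarz.
Context {R : realType} {V : normedModType R}.

Lemma is_derive_line (f : V -> R) (y u : V) (s : R) :
    differentiable f (s *: u + y) ->
  is_derive s 1 (fun t : R => f (t *: u + y)) ('d f (s *: u + y) u).
Proof.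
move=> df.
have dl : is_diff s (fun t : R => t *: u + y) ( *:%R ^~ u + 0).
  by apply: is_diffD.
have dc : is_diff s (f \o (fun t : R => t *: u + y))
    ('d f (s *: u + y) \o ( *:%R ^~ u + 0)).
  by apply: is_diff_comp; apply: differentiableP.
have dfl := @ex_diff _ _ _ _ _ _ _ dc.
apply: DeriveDef; first exact: diff_derivable.
by rewrite deriveE // diff_val /= fctE addr0 scale1r.
Qed.

(** The second difference along [u] and [v] is symmetric in [u] and [v] and
    approximates the iterated derivative: apply the mean value theorem in the
    direction [u], then the first-order expansion at [x] of the derivative
    along [u]. *)
Lemma second_difference_bound (f : V -> R) (x u v : V) (e : R) :
    (\forall y \near x, differentiable f y) ->
    differentiable (fun y => 'd f y u : R) x -> 0 < e ->
  \forall h \near 0^'+, `|f (h *: u + (h *: v + x)) - f (h *: u + x)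
      - (f (h *: v + x) - f x) - h ^+ 2 * 'd (fun y => 'd f y u : R) x v|
    <= e * (`|u| + `|v| + `|u|) * h ^+ 2.
Proof.
set psi := (fun y => 'd f y u : R) => df dpsi e0.
have df0 : \forall y \near 0, differentiable f (y + x).
  by move: df; rewrite (near_shift 0) subr0.
have /eqaddoP /(_ _ e0) psio := diff_locally dpsi.
have [/= d d0 dP] : exists2 d : R, 0 < d & forall y : V, `|y| < d ->
    differentiable f (y + x) /\
    `|psi (y + x) - psi x - 'd psi x y| <= e * `|y|.
  have [d /= d0 dP] := iffLR (nbhs_ballP _ _) (filterI df0 psio).
  exists d => // y yd; have [|? ] := dP y.
    by rewrite -ball_normE /= sub0r normrN.
  by rewrite /= !fctE /= /cst opprD addrA.
near=> h.
have h0 : 0 < h by [].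
have hd : h * (`|u| + `|v|) < d.
  have uv0 : 0 < `|u| + `|v| + 1 by rewrite ltr_wpDl// addr_ge0.
  have : h < d / (`|u| + `|v| + 1).
    by near: h; apply: nbhs_right_lt; rewrite divr_gt0.
  by rewrite ltr_pdivlMr//; apply: le_lt_trans; rewrite ler_pM2l// lerDl.
have inball t : 0 <= t <= h -> `|t *: u + h *: v| < d /\ `|t *: u| < d.
  move=> /andP[t0 th]; split; last first.
    apply: le_lt_trans hd; rewrite normrZ ger0_norm// mulrDr.
    by rewrite (le_trans (ler_wpM2r _ th))// lerDl mulr_ge0// ltW.
  apply: le_lt_trans hd; rewrite (le_trans (ler_normD _ _))// mulrDr.
  rewrite !normrZ (ger0_norm t0) (gtr0_norm h0) lerD2r.
  exact: ler_wpM2r.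
(* [k h - k 0] is the second difference. *)
pose k t := f (t *: u + (h *: v + x)) - f (t *: u + x).
pose dk t := psi (t *: u + (h *: v + x)) - psi (t *: u + x).
have kder t : 0 <= t <= h -> is_derive t 1 k (dk t).
  move=> /inball[t1 t2]; apply: is_deriveB; apply: is_derive_line.
    by rewrite addrA; have [] := dP _ t1.
  by have [] := dP _ t2.
have [c /andP[c0 ch] kc] : exists2 c, 0 <= c <= h & k h - k 0 = dk c * (h - 0).
  have [||c chi ->] := @MVT R k dk 0 h h0.
  - by move=> t; rewrite in_itv/= => /andP[t0 th]; apply: kder; rewrite !ltW.
  - apply: derivable_within_continuous => t; rewrite in_itv/= => th.
    exact: (@ex_derive _ _ _ _ _ _ _ (kder t th)).
  by exists c => //; move: chi; rewrite in_itv/= => /andP[? ?]; rewrite !ltW.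
have -> : f (h *: u + (h *: v + x)) - f (h *: u + x) - (f (h *: v + x) - f x)
    = dk c * h.
  by rewrite subr0 in kc; rewrite -kc /k scale0r !add0r.
have [c1 c2] := inball c (introT andP (conj c0 ch)).
have [_ b1] := dP _ c1; have [_ b2] := dP _ c2.
have -> : dk c * h - h ^+ 2 * 'd psi x v =
    ((psi (c *: u + h *: v + x) - psi x - 'd psi x (c *: u + h *: v))
     - (psi (c *: u + x) - psi x - 'd psi x (c *: u))) * h.
  rewrite linearD !linearZ /dk addrA /=.
  rewrite /GRing.scale /=; ring.
rewrite normrM (gtr0_norm h0) (expr2 h) mulrA.
apply: ler_wpM2r; first exact: ltW.
apply: le_trans (ler_normB _ _) _.
apply: le_trans (lerD b1 b2) _.
rewrite -mulrDr -mulrA ler_pM2l// mulrDl mulrDl lerD//.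
  apply: le_trans (ler_normD _ _) _; rewrite !normrZ (ger0_norm c0) (gtr0_norm h0).
  by rewrite (mulrC _ h) (mulrC _ h) lerD2r ler_wpM2r.
by rewrite normrZ (ger0_norm c0) mulrC ler_wpM2l.
Unshelve. all: by end_near. Qed.

(** Both iterated derivatives, times [h ^ 2], are within [o(h ^ 2)] of the
    same second difference. *)
Lemma schwarz_real (f : V -> R) (x u v : V) :
    (\forall y \near x, differentiable f y) ->
    differentiable (fun y => 'd f y u : R) x ->
    differentiable (fun y => 'd f y v : R) x ->
  'd (fun y => 'd f y u : R) x v = 'd (fun y => 'd f y v : R) x u.
Proof.
move=> df du dv; apply/eqP; rewrite -subr_eq0 -normr_le0; apply/ler_addgt0Pl => e e0.
rewrite addr0.
(* The two error terms add up to [3 (|u| + |v|)] times the accuracy chosen;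
   the [+ 1] keeps [C] positive when [u = v = 0]. *)
pose C := 3 * (`|u| + `|v|) + 1.
have C0 : 0 < C by rewrite ltr_wpDl// mulr_ge0// addr_ge0.
have eC : 0 < e / C by rewrite divr_gt0.
near (0:R)^'+ => h.
have h0 : 0 < h by [].
have hu : `|f (h *: u + (h *: v + x)) - f (h *: u + x)
      - (f (h *: v + x) - f x) - h ^+ 2 * 'd (fun y => 'd f y u : R) x v|
    <= e / C * (`|u| + `|v| + `|u|) * h ^+ 2.
  by near: h; apply: second_difference_bound.
have hv : `|f (h *: v + (h *: u + x)) - f (h *: v + x)
      - (f (h *: u + x) - f x) - h ^+ 2 * 'd (fun y => 'd f y v : R) x u|
    <= e / C * (`|v| + `|u| + `|v|) * h ^+ 2.
  by near: h; apply: second_difference_bound.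
have h20 : 0 < h ^+ 2 by rewrite exprn_gt0.
rewrite -(ler_pM2r h20) -[in leLHS](gtr0_norm h20) -normrM.
have vuE : h *: v + (h *: u + x) = h *: u + (h *: v + x) by rewrite addrCA.
rewrite vuE in hv.
set D := 'd _ x v in hu *; set D' := 'd _ x u in hv *.
set a := f _ in hu hv; set b := f _ in hu hv; set c := f _ in hu hv.
set d := f _ in hu hv.
have -> : (D - D') * h ^+ 2 =
    (a - c - (b - d) - h ^+ 2 * D') - (a - b - (c - d) - h ^+ 2 * D) by ring.
apply: le_trans (ler_normB _ _) _; apply: le_trans (lerD hv hu) _.
rewrite -mulrDl ler_pM2r// -mulrDr mulrAC ler_pdivrMr// ler_pM2l// /C.
by lra.
Unshelve. all: by end_near. Qed.

End Schwarz.

Lemma diff_scaleD (R : realType) (V W : normedModType R) (f g : V -> W) (x : V)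
    (a : R) (v : V) : differentiable f x -> differentiable g x ->
  'd (a *: f + g) x v = a *: 'd f x v + 'd g x v.
Proof.
move=> df dg.
have := @diff_val _ _ _ _ _ _ _
  (is_diffD (is_diffZ a (differentiableP df)) (differentiableP dg)).
by move=> /(congr1 (@^~ v)).
Qed.

(** The left-hand side is the coordinate formula for a Lie bracket of vector
    fields. *)
Lemma diff_bracket_linear (R : realType) (V : normedModType R) (f g k : V -> V)
    (x : V) (a : R) : differentiable f x -> differentiable g x ->
  'd k x ((a *: f + g) x) - 'd (a *: f + g) x (k x) =
  a *: ('d k x (f x) - 'd f x (k x)) + ('d k x (g x) - 'd g x (k x)).
Proof.
move=> df dg; rewrite (diff_scaleD a (k x) df dg).
rewrite -[(a *: f + g) x]/(a *: f x + g x) linearP.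
by rewrite scalerBr opprD addrACA.
Qed.

Section VectorSchwarz.
Context {R : realType} {V : normedModType R} {m : nat}.

Lemma diff_coord (f : V -> 'rV[R]_m) (x : V) (j : 'I_m) : differentiable f x ->
  differentiable (fun y => f y 0 j) x /\
  forall u, 'd (fun y => f y 0 j) x u = 'd f x u 0 j.
Proof.
move=> df; have dc := differentiable_coord (f x) 0 j.
split; first exact: (differentiable_comp df dc).
have @l : {linear 'rV[R]_m -> R}.
  by exists (fun N : 'rV[R]_m => N 0 j); do 2![eexists]; do ?[constructor];
     rewrite ?mxE// => ? *; rewrite ?mxE//; move=> ?; rewrite !mxE.
have lc : continuous l by exact: coord_continuous.
by move=> u; rewrite (diff_comp df dc) /= (@diff_lin _ _ _ l _ lc).
Qed.

Lemma schwarz (f : V -> 'rV[R]_m) (x u v : V) :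
    (\forall y \near x, differentiable f y) ->
    differentiable (fun y => 'd f y u) x ->
    differentiable (fun y => 'd f y v) x ->
  'd (fun y => 'd f y u) x v = 'd (fun y => 'd f y v) x u.
Proof.
move=> df du dv; apply/rowP => j.
have dfj w : differentiable (fun y => 'd f y w) x ->
    differentiable (fun y => 'd (fun y => f y 0 j) y w) x /\
    forall w', 'd (fun y => 'd (fun y => f y 0 j) y w) x w' =
               'd (fun y => 'd f y w) x w' 0 j.
  move=> dw; have [d1 d1E] := diff_coord j dw.
  have [|d2 d2E] := @diff_near_eq _ _ _ _
      (fun y => 'd (fun y => f y 0 j) y w) x _ d1.
    by near=> y; rewrite (diff_coord j _).2//; near: y.
  by split=> // w'; rewrite d2E d1E.
have [du1 duE] := dfj _ du; have [dv1 dvE] := dfj _ dv.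
rewrite -duE -dvE; apply: schwarz_real => //.
by apply: filterS df => y /(diff_coord j)[].
Unshelve. all: by end_near. Qed.

End VectorSchwarz.

(** * Smooth maps and partial differentials *)

Section CkTheory.
Context {R : realType}.

Lemma eq_Ck (V W : normedModType R) k (A : set V) (f g : V -> W) :
  open A -> (forall x, A x -> f x = g x) -> Ck k A f -> Ck k A g.
Proof.
move=> oA; elim: k f g => [|k IH] f g fg /=.
  move=> cf x Ax; rewrite /prop_for /continuous_at -fg//.
  apply: cvg_trans (cf x Ax); apply: near_eq_cvg.
  by apply: filterS (open_nbhs_nbhs (conj oA Ax)) => y; exact: fg.
move=> [df dfk]; have dfg x : A x ->
    differentiable g x /\ 'd g x = 'd f x :> (V -> W).
  move=> Ax; apply: diff_near_eq (df x Ax).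
  by apply: filterS (open_nbhs_nbhs (conj oA Ax)) => y; exact: fg.
split=> [x /dfg[]//|v]; apply: IH (dfk v) => x /dfg[_ ->] //.
Qed.

(** For an affine [j] the differential [l] is the same at all points, so that
    [x |-> 'd (f \o j) x v] is again a composite with [j], namely of
    [y |-> 'd f y (l v)]; the induction on [k] then needs no product rule. *)
Lemma Ck_comp_affine (V1 V2 W : normedModType R) k (A : set V1) (U : set V2)
    (f : V2 -> W) (j l : V1 -> V2) :
    open A -> (forall x, A x -> U (j x)) -> (forall x, is_diff x j l) ->
  Ck k U f -> Ck k A (f \o j).
Proof.
move=> oA AU jl; elim: k f => [|k IH] f /=.
  move=> cf x Ax; apply: continuous_comp; last exact: cf (AU _ Ax).
  exact/differentiable_continuous/(@ex_diff _ _ _ _ _ _ _ (jl x)).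
move=> [df dfk].
have dj x : differentiable j x := @ex_diff _ _ _ _ _ _ _ (jl x).
split=> [x Ax|v]; first exact: differentiable_comp (dj x) (df _ (AU _ Ax)).
apply: eq_Ck (IH _ (dfk (l v))) => // x Ax /=.
rewrite (diff_comp (dj x) (df _ (AU _ Ax))) /=.
by rewrite (@diff_val _ _ _ _ _ _ _ (jl x)).
Qed.

Lemma is_diff_pair_r (V1 V2 : normedModType R) (x0 : V1) (y : V2) :
  is_diff y (fun y => (x0, y)) (fun v => (0, v)).
Proof. exact: is_diff_pair. Qed.

Lemma is_diff_pair_l (V1 V2 : normedModType R) (x : V1) (y0 : V2) :
  is_diff x (fun x => (x, y0)) (fun v => (v, 0)).
Proof. exact: is_diff_pair. Qed.

Lemma diff_slice_r (V1 V2 W : normedModType R) (f : V1 * V2 -> W) (x : V1)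
    (y : V2) : differentiable f (x, y) ->
  differentiable (fun y => f (x, y)) y /\
  forall v, 'd (fun y => f (x, y)) y v = 'd f (x, y) (0, v).
Proof.
move=> df; have dp := @is_diff_pair_r _ _ x y.
have dp' := @ex_diff _ _ _ _ _ _ _ dp.
split=> [|v]; first exact: (differentiable_comp dp' df).
by rewrite (diff_comp dp' df) /= (@diff_val _ _ _ _ _ _ _ dp).
Qed.

Lemma diff_slice_l (V1 V2 W : normedModType R) (f : V1 * V2 -> W) (x : V1)
    (y : V2) : differentiable f (x, y) ->
  differentiable (fun x => f (x, y)) x /\
  forall v, 'd (fun x => f (x, y)) x v = 'd f (x, y) (v, 0).
Proof.
move=> df; have dp := @is_diff_pair_l _ _ x y.
have dp' := @ex_diff _ _ _ _ _ _ _ dp.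
split=> [|v]; first exact: (differentiable_comp dp' df).
by rewrite (diff_comp dp' df) /= (@diff_val _ _ _ _ _ _ _ dp).
Qed.

End CkTheory.

(** * Limits of forms *)

Section Limits.
Context {R : realType}.

(** In finite dimension pointwise convergence of linear forms suffices to let
    the argument vary as well: expand the argument in the standard basis. *)
Lemma cvg_linear_family n (T : Type) (F : set_system T) (L : T -> 'rV[R]_n -> R)
    (L0 : 'rV[R]_n -> R) (q : T -> 'rV[R]_n) (q0 : 'rV[R]_n) :
    Filter F -> (forall t, scalar (L t)) -> scalar L0 ->
    (forall i, L t (delta_mx 0 i) @[t --> F] --> L0 (delta_mx 0 i)) ->
    q t @[t --> F] --> q0 ->
  L t (q t) @[t --> F] --> L0 q0.
Proof.
move=> FF linL linL0 cL cq.
have LE (l : 'rV[R]_n -> R) r : scalar l ->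
    l r = \sum_i r 0 i * l (delta_mx 0 i).
  move=> linl.
  pose lM := GRing.isLinear.Build _ _ _ _ _ linl.
  pose lL : {scalar 'rV[R]_n} := HB.pack l lM.
  transitivity (lL (\sum_i r 0 i *: delta_mx 0 i)).
    by rewrite -row_sum_delta.
  rewrite linear_sum.
  by apply: eq_bigr => i _; rewrite linearZ.
rewrite LE//; under eq_cvg do rewrite LE//.
apply: cvg_big => [|i _]; first exact: add_continuous.
apply: cvgM => //.
exact: (cvg_comp _ _ cq (@coord_continuous _ _ _ 0 i q0)).
Qed.

Lemma cvg_diff_quotient (V W : normedModType R) (f : V -> W) (x v : V) :
  differentiable f x ->
  h^-1 *: (f (h *: v + x) - f x) @[h --> (0:R)^'] --> 'd f x v.
Proof.
by move=> df; have := @diff_derivable _ _ _ f x v df; rewrite -deriveE.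
Qed.

End Limits.

(** * Computing differentials through charts *)

Section Charts.
Context {R : realType} {n : nat} {M : topologicalType}.

Lemma near_dom (T : topologicalType) (c : chart R n M) (f : T -> M) (t : T) :
  {for t, continuous f} -> dom c (f t) -> \forall s \near t, dom c (f s).
Proof.
move=> cf ct; apply: (cf (dom c)); apply: open_nbhs_nbhs; split=> //.
exact: dom_open.
Qed.

Lemma near_cod (c : chart R n M) (x : 'rV[R]_n) :
  cod c x -> \forall y \near x, cod c y.
Proof. by move=> cx; apply: open_nbhs_nbhs; split=> //; exact: cod_open. Qed.

(** The chain rule through an intermediate manifold: [psi \o f] is read through
    a chart [c] around [q].  The point is named [q], with [f x = q], because the
    products met below equal the intended point only after simplification by the
    group laws and the chart. *)
Lemma diff_chart_comp (V W : normedModType R) (c : chart R n M) (f : V -> M)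
    (psi : M -> W) (x : V) (q : M) :
    f x = q -> dom c q -> {for x, continuous f} ->
    differentiable (fun y => c (f y)) x ->
    differentiable (fun y => psi (of_coord c y)) (c q) ->
  forall v, 'd (fun y => psi (f y)) x v =
    'd (fun y => psi (of_coord c y)) (c q) ('d (fun y => c (f y)) x v).
Proof.
move=> <- cfx cf df dpsi.
have [|_ dE] := @diff_near_eq _ _ _ _ (fun y => psi (f y)) x _
    (differentiable_comp df dpsi).
  by apply: filterS (near_dom cf cfx) => y cy /=; rewrite to_coordK.
move=> v; rewrite dE.
by rewrite (@diff_comp _ _ _ _ (fun y => c (f y)) (fun y => psi (of_coord c y))).
Qed.

Lemma diff_chart_id (c : chart R n M) (x v : 'rV[R]_n) : cod c x ->
  'd (fun y => c (of_coord c y)) x v = v.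
Proof.
move=> cx; have did := is_diff_id x.
have [|_ ->] := @diff_near_eq _ _ _ id (fun y => c (of_coord c y)) x _
    (@ex_diff _ _ _ _ _ _ _ did).
  by apply: filterS (near_cod cx) => y cy; rewrite of_coordK.
by rewrite diff_val.
Qed.

End Charts.

(** * The multiplication in coordinates *)

Section LieGroup.
Context {R : realType} {n : nat} {G : lieGroupType R n}.
Implicit Types (a b c : chart R n G) (h p q : G) (u v w : 'rV[R]_n).

Definition mul_coord a b c (z : 'rV[R]_n * 'rV[R]_n) : 'rV[R]_n :=
  c (of_coord a z.1 * of_coord b z.2)%g.

Definition mul_dom a b c : set ('rV[R]_n * 'rV[R]_n) :=
  [set z | [/\ cod a z.1, cod b z.2 & dom c (of_coord a z.1 * of_coord b z.2)%g]].

Lemma mul_coord_smooth a b c : atlas G a -> atlas G b -> atlas G c ->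
  smooth_on (mul_dom a b c) (mul_coord a b c).
Proof. exact: mulg_smooth. Qed.

Lemma cvg_mulg (T : topologicalType) (f g : T -> G) (t : T) :
  {for t, continuous f} -> {for t, continuous g} ->
  {for t, continuous (fun s => f s * g s)%g}.
Proof.
move=> cf cg; have mc := @mulg_continuous R n G (f t, g t).
exact: (continuous2_cvg _ (h := fun x y : G => (x * y)%g) mc cf cg).
Qed.

Lemma near_mul_dom a b c z : mul_dom a b c z ->
  \forall z' \near z, mul_dom a b c z'.
Proof.
move=> [az bz cz].
have a1 : \forall z' \near z, cod a z'.1.
  exact: (cvg_fst (near_cod az)).
have b1 : \forall z' \near z, cod b z'.2.
  exact: (cvg_snd (near_cod bz)).
have cm : {for z, continuous (fun z' => of_coord a z'.1 * of_coord b z'.2)%g}.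
  apply: cvg_mulg.
    by apply: continuous_comp; [exact: cvg_fst|exact: of_coord_continuous].
  by apply: continuous_comp; [exact: cvg_snd|exact: of_coord_continuous].
have c1 := near_dom cm cz.
by near=> z'; split; near: z'.
Unshelve. all: by end_near. Qed.

Lemma lmul_diff b a c h y : atlas G b -> atlas G a -> atlas G c ->
    dom b h -> cod a y -> dom c (h * of_coord a y)%g ->
  differentiable (fun y => c (h * of_coord a y)%g) y /\
  forall u, 'd (fun y => c (h * of_coord a y)%g) y u =
            'd (mul_coord b a c) (b h, y) (0, u).
Proof.
move=> Gb Ga Gc bh ay ch.
have [dm _] := mul_coord_smooth Gb Ga Gc 1.
have dmy : differentiable (mul_coord b a c) (b h, y).
  by apply: dm; split=> /=; rewrite ?to_coordK//; exact: to_coord_cod.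
have -> : (fun y => c (h * of_coord a y)%g)
    = (fun y => mul_coord b a c (b h, y)).
  by apply/funext => y' /=; rewrite /mul_coord /= to_coordK.
exact: diff_slice_r.
Qed.

Lemma rmul_diff a b c h x : atlas G a -> atlas G b -> atlas G c ->
    cod a x -> dom b h -> dom c (of_coord a x * h)%g ->
  differentiable (fun x => c (of_coord a x * h)%g) x /\
  forall u, 'd (fun x => c (of_coord a x * h)%g) x u =
            'd (mul_coord a b c) (x, b h) (u, 0).
Proof.
move=> Ga Gb Gc ax bh ch.
have [dm _] := mul_coord_smooth Ga Gb Gc 1.
have dmx : differentiable (mul_coord a b c) (x, b h).
  by apply: dm; split=> /=; rewrite ?to_coordK//; exact: to_coord_cod.
have -> : (fun x => c (of_coord a x * h)%g)
    = (fun x => mul_coord a b c (x, b h)).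
  by apply/funext => y' /=; rewrite /mul_coord /= to_coordK.
exact: diff_slice_l.
Qed.

End LieGroup.

(** * Left-invariant vector fields *)

Section LeftFields.
Context {R : realType} {n : nat} {G : lieGroupType R n}.
Implicit Types (c d : chart R n G) (h p q : G) (u v w : 'rV[R]_n).

Local Notation c1 := (chart_at (1%g : G)).
Local Notation x1 := (chart_at (1%g : G) (1%g : G)).

Lemma continuous_lmul_coord c h y : cod c y ->
  {for y, continuous (fun y => h * of_coord c y)%g}.
Proof.
move=> cy; apply: cvg_mulg; last exact: of_coord_continuous.
by apply: cst_continuous.
Qed.

Lemma continuous_rmul_coord c h y : cod c y ->
  {for y, continuous (fun y => of_coord c y * h)%g}.
Proof.
move=> cy; apply: cvg_mulg; first exact: of_coord_continuous.
by apply: cst_continuous.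
Qed.

Lemma lmul_diff_chart a c h p : atlas G a -> atlas G c -> dom a p ->
    dom c (h * p)%g ->
  differentiable (fun y => c (h * of_coord a y)%g) (a p).
Proof.
move=> Ga Gc ap cp.
apply: (lmul_diff (chart_at_atlas h) Ga Gc (chart_at_dom h) _ _).1.
  exact: to_coord_cod.
by rewrite to_coordK.
Qed.

Lemma transition_diff c d q : atlas G c -> atlas G d -> dom c q -> dom d q ->
  differentiable (fun x => d (of_coord c x)) (c q).
Proof.
move=> Gc Gd cq dq; have [df _] := atlas_compatible c d Gc Gd 1.
by apply: df; split; [exact: to_coord_cod|rewrite to_coordK].
Qed.

Lemma tangent_mapM h k p v :
  tangent_map (fun q => h * q)%g (k * p)%g (tangent_map (fun q => k * q)%g p v)
  = tangent_map (fun q => h * k * q)%g p v.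
Proof.
have cp := chart_at_dom p; have Gp := chart_at_atlas p.
have ckp := chart_at_dom (k * p)%g; have Gkp := chart_at_atlas (k * p)%g.
rewrite /tangent_map; under [in RHS]eq_fun do rewrite -!mulgA.
apply/esym; apply: (diff_chart_comp (c := chart_at (k * p)%g)
  (f := (fun x => k * of_coord (chart_at p) x)%g)
  (psi := (fun q => chart_at (h * (k * p)) (h * q))%g)) => //.
- by rewrite to_coordK.
- exact: continuous_lmul_coord (to_coord_cod cp).
- exact: lmul_diff_chart.
- by apply: lmul_diff_chart => //; exact: chart_at_atlas || exact: chart_at_dom.
Qed.

Lemma tangent_map_lmul1 p v : tangent_map (fun q => 1 * q)%g p v = v.
Proof.
rewrite (_ : (fun q : G => 1 * q)%g = id); last by apply/funext => q; rewrite mul1g.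
by apply: diff_chart_id; exact: to_coord_cod (chart_at_dom p).
Qed.

Definition left_field u : G -> 'rV[R]_n :=
  fun q => tangent_map (fun z => q * z)%g 1%g u.

Lemma left_field_invariant u : left_invariant (left_field u).
Proof.
by move=> h p; have := tangent_mapM h p 1%g u; rewrite mulg1.
Qed.

Lemma left_field_eq X : left_invariant X -> X = left_field (X 1%g).
Proof.
by move=> iX; apply/funext => p; rewrite /left_field iX mulg1.
Qed.

Lemma left_field_surj p v : exists u, left_field u p = v.
Proof.
exists (tangent_map (fun q => p^-1 * q)%g p v).
by have := tangent_mapM p p^-1%g p v; rewrite mulgV mulVg tangent_map_lmul1.
Qed.

Lemma left_field_linear p a u v :
  left_field (a *: u + v) p = a *: left_field u p + left_field v p.
Proof. exact: linearP. Qed.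

Lemma tangent_to_coord_linear c p : linear (tangent_to_coord c p).
Proof. exact: linearP. Qed.

Lemma tangent_to_coord_left_field c q u : atlas G c -> dom c q ->
  tangent_to_coord c q (left_field u q)
  = 'd (fun y => c (q * of_coord c1 y)%g) x1 u.
Proof.
move=> Gc cq; rewrite /tangent_to_coord /left_field /tangent_map mulg1.
have c1d := chart_at_dom (1%g : G); have G1 := chart_at_atlas (1%g : G).
have qd := chart_at_dom q; have Gq := chart_at_atlas q.
apply/esym; apply: (diff_chart_comp (c := chart_at q)
  (f := (fun y => q * of_coord c1 y)%g) (psi := c)) => //.
- by rewrite to_coordK// mulg1.
- exact: continuous_lmul_coord (to_coord_cod c1d).
- by apply: lmul_diff_chart => //; rewrite mulg1.
- exact: transition_diff.
Qed.

(** In coordinates a left-invariant field is a partial differential of the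
    multiplication; this is what makes it smooth and ties brackets to second
    derivatives of the multiplication. *)
Lemma left_field_coordE c x u : atlas G c -> cod c x ->
  field_in_coord c (left_field u) x = 'd (mul_coord c c1 c) (x, x1) (0, u).
Proof.
move=> Gc cx; rewrite /field_in_coord.
have cd := of_coord_dom cx.
rewrite tangent_to_coord_left_field//.
have c1d := chart_at_dom (1%g : G); have G1 := chart_at_atlas (1%g : G).
rewrite (lmul_diff Gc G1 Gc cd _ _).2 ?of_coordK//; first exact: to_coord_cod.
by rewrite to_coordK// mulg1.
Qed.

Lemma left_field_smooth u : smooth_field (left_field u).
Proof.
move=> c Gc k.
have G1 := chart_at_atlas (1%g : G); have c1d := chart_at_dom (1%g : G).
have [_ sm] := mul_coord_smooth Gc G1 Gc k.+1.
apply: eq_Ck (Ck_comp_affine _ _ (fun x => is_diff_pair_l x x1) (sm (0, u))).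
- exact: cod_open.
- by move=> x cx /=; rewrite left_field_coordE.
- exact: cod_open.
move=> x cx; split => //=; first exact: to_coord_cod.
by rewrite to_coordK// mulg1; exact: of_coord_dom.
Qed.

End LeftFields.

(** * The bracket as the derivative of left minus right translates *)

Section Bracket.
Context {R : realType} {n : nat} {G : lieGroupType R n}.
Implicit Types (c d : chart R n G) (h p q : G) (u v w : 'rV[R]_n).

Local Notation c1 := (chart_at (1%g : G)).
Local Notation x1 := (chart_at (1%g : G) (1%g : G)).

Lemma left_field_coord_differentiable c p u : atlas G c -> dom c p ->
  differentiable (field_in_coord c (left_field u : G -> _)) (c p).
Proof.
by move=> Gc cp; apply: (left_field_smooth u Gc 1).1; exact: to_coord_cod.
Qed.

Lemma lie_bracket_linear_l w p :
  linear (fun u => lie_bracket (left_field u) (left_field w) p).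
Proof.
move=> a u v; rewrite /lie_bracket.
have Gc := chart_at_atlas p; have cp := chart_at_dom p.
have FE : field_in_coord (chart_at p) (left_field (a *: u + v))
    = a *: field_in_coord (chart_at p) (left_field u)
      + field_in_coord (chart_at p) (left_field v).
  apply/funext => x; rewrite /field_in_coord left_field_linear.
  exact: tangent_to_coord_linear.
have du := left_field_coord_differentiable u Gc cp.
have dv := left_field_coord_differentiable v Gc cp.
rewrite FE.
exact: diff_bracket_linear.
Qed.

Lemma lie_bracket_antisym (X Y : G -> 'rV[R]_n) p :
  lie_bracket X Y p = - lie_bracket Y X p.
Proof. by rewrite /lie_bracket opprB. Qed.

(** Isometries are stated for tangent vectors, whose coordinates refer to the
    distinguished chart at each point, whereas the curves are followed in one
    fixed chart [c]; this and [tangent_of_coord_rmul] convert between the two. *)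
Lemma tangent_of_coord_left_field c q u : atlas G c -> dom c q ->
  tangent_of_coord c q ('d (mul_coord c c1 c) (c q, x1) (0, u)) = left_field u q.
Proof.
move=> Gc cq.
have c1d := chart_at_dom (1%g : G); have G1 := chart_at_atlas (1%g : G).
rewrite -(lmul_diff Gc G1 Gc cq (to_coord_cod c1d) _).2; last first.
  by rewrite to_coordK// mulg1.
rewrite /tangent_of_coord /left_field /tangent_map mulg1.
have qd := chart_at_dom q; have Gq := chart_at_atlas q.
apply/esym; apply: (diff_chart_comp (c := c)
  (f := (fun y => q * of_coord c1 y)%g) (psi := chart_at q)) => //.
- by rewrite to_coordK// mulg1.
- exact: continuous_lmul_coord (to_coord_cod c1d).
- by apply: lmul_diff_chart => //; rewrite mulg1.
- exact: transition_diff.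
Qed.

Lemma tangent_of_coord_rmul p y v : let c := chart_at p in
    let z := of_coord c1 y in cod c1 y -> dom c (p * z)%g ->
  tangent_of_coord c (p * z)%g ('d (mul_coord c c1 c) (c p, y) (v, 0)) =
  tangent_map (fun q => q * z)%g p v.
Proof.
move=> c z c1y cq.
have G1 := chart_at_atlas (1%g : G); have Gc := chart_at_atlas p.
have cp := chart_at_dom p; have c1z : dom c1 z by exact: of_coord_dom.
have cq' : dom c (of_coord c (c p) * z)%g by rewrite to_coordK.
have [d dE] := rmul_diff Gc G1 Gc (to_coord_cod cp) c1z cq'.
have yE : y = c1 z by rewrite of_coordK.
rewrite yE -dE /tangent_of_coord /tangent_map.
apply/esym; apply: (diff_chart_comp (c := c)
  (f := (fun x => of_coord c x * z)%g) (psi := chart_at (p * z)%g)) => //.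
- by rewrite to_coordK.
- exact: continuous_rmul_coord (to_coord_cod cp).
- by apply: transition_diff => //; [exact: chart_at_atlas|exact: chart_at_dom].
Qed.

Section Curves.
Variables (p : G) (u : 'rV[R]_n).

Local Notation c := (chart_at p).
Local Notation xp := (chart_at p p).
Local Notation m := (mul_coord c c1 c).

(** Coordinates of [p * z] as a function of the coordinates [y] of [z]. *)
Definition rtrans (y : 'rV[R]_n) : 'rV[R]_n := m (xp, y).

(** Coordinates at [p * z] of the left-invariant field, as a function of the
    coordinates [y] of [z]. *)
Definition left_curve (y : 'rV[R]_n) : 'rV[R]_n := 'd m (rtrans y, x1) (0, u).

(** Coordinates at [p * z] of the right translate by [z] of the value of the
    field at [p]. *)
Definition right_curve (y : 'rV[R]_n) : 'rV[R]_n :=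
  'd m (xp, y) (left_field u p, 0).

Lemma rtransE y : rtrans y = c (p * of_coord c1 y)%g.
Proof. by rewrite /rtrans /mul_coord /= to_coordK//; exact: chart_at_dom. Qed.

Lemma rtrans1 : rtrans x1 = xp.
Proof. by rewrite rtransE to_coordK ?mulg1//; exact: chart_at_dom. Qed.

Lemma mul_dom1 : mul_dom c c1 c (xp, x1).
Proof.
have cp := chart_at_dom p; have c1d := chart_at_dom (1%g : G).
split=> /=; [exact: to_coord_cod|exact: to_coord_cod|].
by rewrite !to_coordK// mulg1.
Qed.

Lemma rtrans_diff : differentiable rtrans x1 /\
  forall v, 'd rtrans x1 v = 'd m (xp, x1) (0, v).
Proof.
have cp := chart_at_dom p; have c1d := chart_at_dom (1%g : G).
have cpx : dom c (p * of_coord c1 x1)%g by rewrite to_coordK// mulg1.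
have := lmul_diff (chart_at_atlas p) (chart_at_atlas (1%g : G))
  (chart_at_atlas p) cp (to_coord_cod c1d) cpx.
by rewrite (_ : (fun y => _) = rtrans)//; apply/funext => y; rewrite rtransE.
Qed.

Lemma left_field_coord_at v :
  field_in_coord c (left_field v : G -> _) xp = left_field v p.
Proof.
have cp := chart_at_dom p.
rewrite /field_in_coord (to_coordK cp).
exact: (diff_chart_id _ (to_coord_cod cp)).
Qed.

Lemma left_field_coord_diff v :
  differentiable (fun x => 'd m (x, x1) (0, v)) xp /\
  'd (fun x => 'd m (x, x1) (0, v)) xp =
    'd (field_in_coord c (left_field v : G -> _)) xp :> (_ -> _).
Proof.
have cp := chart_at_dom p; have Gc := chart_at_atlas p.
apply: diff_near_eq; last exact: left_field_coord_differentiable.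
apply: filterS (near_cod (to_coord_cod cp)) => x cx.
exact: left_field_coordE.
Qed.

Lemma left_curve1 : left_curve x1 = left_field u p.
Proof.
rewrite /left_curve rtrans1 -left_field_coord_at.
have cp := chart_at_dom p; have Gc := chart_at_atlas p.
by apply/esym/left_field_coordE => //; exact: to_coord_cod.
Qed.

Lemma right_curve1 : right_curve x1 = left_field u p.
Proof.
have cp := chart_at_dom p; have c1d := chart_at_dom (1%g : G).
have cpx : dom c (of_coord c xp * 1)%g by rewrite to_coordK// mulg1.
have [_ E] := rmul_diff (chart_at_atlas p) (chart_at_atlas (1%g : G))
  (chart_at_atlas p) (to_coord_cod cp) c1d cpx.
rewrite /right_curve -E; under eq_fun do rewrite mulg1.
exact: (diff_chart_id _ (to_coord_cod cp)).
Qed.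

(** The left curve is the field along [rtrans], whose velocity in the direction
    [w] is the value at [p] of the left-invariant field of [w]. *)
Lemma left_curve_diff : differentiable left_curve x1 /\
  forall w, 'd left_curve x1 w =
    'd (field_in_coord c (left_field u)) xp (left_field w p).
Proof.
have [dk dkE] := rtrans_diff.
have [dA dAE] := left_field_coord_diff u.
have dA' := dA; rewrite -rtrans1 in dA'.
split=> [|w]; first exact: (differentiable_comp dk dA').
apply: etrans (congr1 (@^~ w) (diff_comp dk dA')) _.
have cp := chart_at_dom p; have Gc := chart_at_atlas p.
have kw : 'd rtrans x1 w = left_field w p.
  apply: etrans (dkE w) _; apply: etrans (left_field_coord_at w).
  exact/esym/(left_field_coordE w Gc (to_coord_cod cp)).
apply: etrans (congr1 ('d (fun x => 'd m (x, x1) (0, u)) (rtrans x1)) kw) _.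
rewrite rtrans1; exact: (congr1 (@^~ (left_field w p)) dAE).
Qed.

(** Here the direction [w] of differentiation and the vector [left_field u p]
    must be exchanged: the derivative in the second variable of
    [D_1 m (p, y) (U p)] is by symmetry the derivative in the first variable,
    along [U p], of [D_2 m (x, 1) w], the coordinates of the field of [w]. *)
Lemma right_curve_diff : differentiable right_curve x1 /\
  forall w, 'd right_curve x1 w =
    'd (field_in_coord c (left_field w)) xp (left_field u p).
Proof.
have G1 := chart_at_atlas (1%g : G); have Gc := chart_at_atlas p.
have [dm dm2] := mul_coord_smooth Gc G1 Gc 2.
set U := left_field u p.
have dd s : differentiable (fun z => 'd m z s) (xp, x1).
  by have [d _] := dm2 s; apply: d; exact: mul_dom1.
have [dr drE] := diff_slice_r (dd (U, 0)).
split=> [|w]; first exact: dr.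
have [_ dlE] := diff_slice_l (dd (0, w)).
have [_ E] := left_field_coord_diff w.
apply: etrans (drE w) _.
apply/esym; apply: etrans (congr1 (@^~ U) (esym E)) _; apply: etrans (dlE U) _.
have near_dm : \forall z \near (xp, x1), differentiable m z.
  by apply: filterS (near_mul_dom mul_dom1) => z; exact: dm.
exact: schwarz near_dm (dd (0, w)) (dd (U, 0)).
Qed.

(** The derivatives of the two curves are the two terms of the coordinate
    formula for the bracket. *)
Lemma curve_diff_bracket w :
  'd (fun y => left_curve y - right_curve y) x1 w =
  lie_bracket (left_field w) (left_field u) p.
Proof.
have [da daE] := left_curve_diff; have [db dbE] := right_curve_diff.
apply: etrans (congr1 (@^~ w) (diffB da db)) _.
rewrite /lie_bracket !left_field_coord_at.
exact: (congr2 (fun x y => x - y) (daE w) (dbE w)).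
Qed.

End Curves.

End Bracket.

(** * Skew-symmetry of the bracket for a bi-invariant metric *)

Section Forms.
Context {R : realType}.

Lemma scalar_add (V : lmodType R) (f : V -> R) x y :
  scalar f -> f (x + y) = f x + f y.
Proof. by move=> lf; have := lf 1 x y; rewrite scale1r mul1r. Qed.

Lemma scalar_zero (V : lmodType R) (f : V -> R) : scalar f -> f 0 = 0.
Proof.
by move=> lf; apply: (addIr (f 0)); rewrite -scalar_add// !add0r.
Qed.

Lemma scalar_scale (V : lmodType R) (f : V -> R) a x :
  scalar f -> f (a *: x) = a * f x.
Proof. by move=> lf; rewrite -[a *: x]addr0 lf scalar_zero// addr0. Qed.

(** The identity [|x|^2 - |y|^2 = (x - y, x + y)].  It turns an equality of
    lengths into an orthogonality in which the small factor [x - y] can be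
    divided by the parameter before passing to the limit. *)
Lemma form_subD (V : lmodType R) (B : V -> V -> R) x y :
    (forall z, scalar (B z)) -> (forall z z', B z z' = B z' z) ->
  B x x = B y y -> B (x - y) (x + y) = 0.
Proof.
move=> lB sB xy.
have BD z s t : B z (s + t) = B z s + B z t by exact: scalar_add.
have BN z s : B z (- s) = - B z s by rewrite -scaleN1r scalar_scale// mulN1r.
rewrite BD (sB (x - y) x) (sB (x - y) y) !BD !BN xy (sB y x).
by ring.
Qed.

Lemma cvg_bilinear_family n (T : Type) (F : set_system T)
    (B : T -> 'rV[R]_n -> 'rV[R]_n -> R) (B0 : 'rV[R]_n -> 'rV[R]_n -> R)
    (q r : T -> 'rV[R]_n) (q0 r0 : 'rV[R]_n) :
    Filter F -> (forall t x, scalar (B t x)) -> (forall t y, scalar (B t ^~ y)) ->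
    (forall x, scalar (B0 x)) -> (forall y, scalar (B0 ^~ y)) ->
    (forall i j, B t (delta_mx 0 i) (delta_mx 0 j) @[t --> F]
       --> B0 (delta_mx 0 i) (delta_mx 0 j)) ->
    q t @[t --> F] --> q0 -> r t @[t --> F] --> r0 ->
  B t (q t) (r t) @[t --> F] --> B0 q0 r0.
Proof.
move=> FF lB lB' lB0 lB0' cB cq cr.
apply: (cvg_linear_family (L := fun t x => B t x (r t)) (L0 := B0 ^~ r0)) => //.
by move=> i; apply: (cvg_linear_family (L := fun t => B t (delta_mx 0 i))).
Qed.

End Forms.

Section Skew.
Context {R : realType} {n : nat} {G : lieGroupType R n}.
Implicit Types (c d : chart R n G) (h p q : G) (u v w : 'rV[R]_n).

Local Notation c1 := (chart_at (1%g : G)).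
Local Notation x1 := (chart_at (1%g : G) (1%g : G)).

Context (g : G -> 'rV[R]_n -> 'rV[R]_n -> R).
Context (g_metric : riemannian_metric g) (g_inv : bi_invariant g).

Let gl p v : scalar (g p v). Proof. by case: g_metric. Qed.
Let gs p v w : g p v w = g p w v. Proof. by case: g_metric. Qed.

Lemma left_field_norm q u : g q (left_field u q) (left_field u q) = g 1%g u u.
Proof.
by have [/(_ 1%g u u) + _] := g_inv q; rewrite mulg1.
Qed.

Definition metric_coord c (x v w : 'rV[R]_n) : R :=
  g (of_coord c x) (tangent_of_coord c (of_coord c x) v)
                   (tangent_of_coord c (of_coord c x) w).

Lemma metric_coord_linear c x v : scalar (metric_coord c x v).
Proof.
move=> a w w'; rewrite /metric_coord.
have -> : forall q, tangent_of_coord c q (a *: w + w') =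
  a *: tangent_of_coord c q w + tangent_of_coord c q w' by move=> q; exact: linearP.
exact: gl.
Qed.

Lemma metric_coord_sym c x v w : metric_coord c x v w = metric_coord c x w v.
Proof. exact: gs. Qed.

Lemma metric_coord_continuous c x v w : atlas G c -> cod c x ->
  {for x, continuous (fun y => metric_coord c y v w)}.
Proof. by move=> Gc; case: g_metric => _ _ _ /(_ c v w Gc 0); exact. Qed.

Lemma metric_coord_chart_at p v w :
  metric_coord (chart_at p) (chart_at p p) v w = g p v w.
Proof.
have cp := chart_at_dom p; rewrite /metric_coord to_coordK//.
have E s : tangent_of_coord (chart_at p) p s = s.
  exact: (diff_chart_id _ (to_coord_cod cp)).
by rewrite !E.
Qed.

(** This is where bi-invariance enters: left translations preserve the length
    of a left-invariant field, and the right translation by [z] maps the vector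
    at [p] to the one at [p * z]. *)
Lemma curves_same_norm p u y : cod c1 y ->
    dom (chart_at p) (p * of_coord c1 y)%g ->
  metric_coord (chart_at p) (rtrans p y) (left_curve p u y) (left_curve p u y) =
  metric_coord (chart_at p) (rtrans p y) (right_curve p u y) (right_curve p u y).
Proof.
move=> c1y cpy; set c := chart_at p; set z := of_coord c1 y.
have Gc := chart_at_atlas p.
rewrite /metric_coord rtransE (to_coordK cpy) -/z.
have -> : tangent_of_coord c (p * z)%g (left_curve p u y) = left_field u (p * z)%g.
  rewrite /left_curve rtransE; exact: tangent_of_coord_left_field.
have -> : tangent_of_coord c (p * z)%g (right_curve p u y) =
    tangent_map (fun q => q * z)%g p (left_field u p).
  exact: tangent_of_coord_rmul.
have [_ gz] := g_inv z.
apply: etrans (left_field_norm _ _) _; apply/esym.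
by apply: etrans (gz p _ _) _; exact: left_field_norm.
Qed.

(** Differentiate [curves_same_norm] along the line [t *: w + x1]. *)
Lemma bracket_skew p u w :
  g p (lie_bracket (left_field w) (left_field u) p) (left_field u p) = 0.
Proof.
set c := chart_at p.
have Gc := chart_at_atlas p; have cp := chart_at_dom p.
have c1d := chart_at_dom (1%g : G).
pose a := left_curve p u; pose b := right_curve p u.
have [da _] := left_curve_diff p u; have [db _] := right_curve_diff p u.
have [dk _] := rtrans_diff p.
pose y (t : R) : 'rV[R]_n := t *: w + x1.
have cy : y t @[t --> (0:R)^'] --> x1.
  have y0 : y 0 = x1 by rewrite /y scale0r add0r.
  rewrite -y0; apply/continuous_withinNx.
  by apply: cvgD; [exact: scalel_continuous|exact: cvg_cst].
(* The last difference is 0; with it [q] is literally a difference quotient. *)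
pose q (t : R) := t^-1 *: ((a (y t) - b (y t)) - (a x1 - b x1)).
pose r (t : R) := a (y t) + b (y t).
have cq : q t @[t --> (0:R)^'] --> lie_bracket (left_field w) (left_field u) p.
  rewrite -curve_diff_bracket.
  exact: (cvg_diff_quotient (f := fun y => a y - b y) (v := w)
    (differentiableB da db)).
have cr : r t @[t --> (0:R)^'] --> left_field u p + left_field u p.
  rewrite -{1}(left_curve1 p u) -(right_curve1 p u).
  apply: cvgD.
    exact: (cvg_comp _ _ cy (differentiable_continuous da)).
  exact: (cvg_comp _ _ cy (differentiable_continuous db)).
have cB i j : metric_coord c (rtrans p (y t)) (delta_mx 0 i) (delta_mx 0 j)
    @[t --> (0:R)^'] --> g p (delta_mx 0 i) (delta_mx 0 j).
  rewrite -metric_coord_chart_at -(rtrans1 p).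
  have ck := cvg_comp _ _ cy (differentiable_continuous dk).
  have := metric_coord_continuous (v := delta_mx 0 i) (w := delta_mx 0 j) Gc
    (to_coord_cod cp).
  rewrite -(rtrans1 p); exact: (cvg_comp _ _ ck).
have clim : metric_coord c (rtrans p (y t)) (q t) (r t) @[t --> (0:R)^'] -->
    g p (lie_bracket (left_field w) (left_field u) p)
        (left_field u p + left_field u p).
  apply: (cvg_bilinear_family (B := fun t => metric_coord c (rtrans p (y t)))
    (B0 := g p) _ _ _ _ _ cB cq cr) => //.
  - by move=> t x; exact: metric_coord_linear.
  - move=> t s k z z'; rewrite !(metric_coord_sym _ _ _ s).
    exact: metric_coord_linear.
  - by move=> s k z z'; rewrite !(gs p _ s) gl.
have near1 : \forall z \near x1, cod c1 z /\ dom c (p * of_coord c1 z)%g.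
  have x1c := to_coord_cod c1d.
  apply: filterI; first exact: near_cod.
  apply: (near_dom (continuous_lmul_coord (h := p) x1c)).
  by rewrite to_coordK// mulg1.
have c0 : metric_coord c (rtrans p (y t)) (q t) (r t) @[t --> (0:R)^'] --> (0:R).
  have near0 : \forall t \near (0:R)^',
      cod c1 (y t) /\ dom c (p * of_coord c1 (y t))%g by exact: cy near1.
  apply: cvg_near_cst; apply: filterS near0 => t [c1y cpy].
  rewrite /q /a /b left_curve1 right_curve1 subrr subr0.
  have lB z := metric_coord_linear c (rtrans p (y t)) z.
  rewrite metric_coord_sym (scalar_scale _ _ (lB _)) metric_coord_sym.
  rewrite form_subD ?mulr0//.
    exact: metric_coord_sym.
  exact: curves_same_norm.
have := cvg_unique (@norm_hausdorff _ R) clim c0.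
by rewrite scalar_add// => /(_ _)/eqP; rewrite -mulr2n mulrn_eq0 => /eqP.
Qed.

End Skew.

(** * The algebraic contradiction *)

Section Algebra.
Context {R : realType} {V W : lmodType R}.

(** Here [phi] evaluates a Lie algebra element at a point and [br] is the value
    of the bracket at that point; keeping [V] and [W] apart avoids transporting
    the bracket along [phi].  The vectors [b0] and [b1] are the values at
    that point of a basis of the derived algebra. *)
Lemma skew_bracket_plane_eq0 (phi : V -> W) (br : V -> V -> W)
    (g : W -> W -> R) (b0 b1 : W) :
    linear phi -> (forall w, exists u, phi u = w) ->
    (forall w, linear (br^~ w)) -> (forall u w, br u w = - br w u) ->
    (forall w, scalar (g w)) -> (forall w w', g w w' = g w' w) ->
    (forall w, w != 0 -> 0 < g w w) ->
    (forall u w, g (br w u) (phi u) = 0) ->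
    (forall u w, exists x y, br u w = x *: b0 + y *: b1) ->
  forall u w, br u w = 0.
Proof.
move=> lphi sphi lbr abr lg sg pg kbr bplane u w.
have lg' z : scalar (g^~ z) by move=> k x y; rewrite !(sg _ z) lg.
have g0 z : g z z = 0 -> z = 0.
  by move=> gz; apply/eqP; apply: contraT => /pg; rewrite gz ltxx.
have phiD x y : phi (x + y) = phi x + phi y.
  by have := lphi 1 x y; rewrite !scale1r.
have br_lin k l x y z : br (k *: x + l *: y) z = k *: br x z + l *: br y z.
  have br0 : br 0 z = 0.
    by have := lbr z (-1) 0 0; rewrite scaler0 addr0 scaleN1r addNr.
  by rewrite lbr -[l *: y]addr0 lbr br0 addr0.
have brr x : br x x = 0.
  (* [br x x] is its own opposite. *)
  have /eqP := abr x x; rewrite -addr_eq0 -mulr2n -scaler_nat scaler_eq0.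
  by rewrite pnatr_eq0 => /eqP.
(* Together with the antisymmetry of [br], skewness makes
   [g (br x y) (phi z)] alternating, hence cyclically invariant. *)
have alt x y z : g (br x y) (phi z) = - g (br x z) (phi y).
  have := kbr (y + z) x; rewrite phiD abr -[y]scale1r -[z]scale1r br_lin.
  rewrite !scale1r (abr y) (abr z) -opprD opprK.
  rewrite (scalar_add _ _ (lg' _)) !(scalar_add _ _ (lg _)) !kbr addr0 add0r.
  by move=> /eqP; rewrite addr_eq0 => /eqP.
have cyc x y z : g (br x y) (phi z) = g (br y z) (phi x).
  by rewrite abr -scaleN1r (scalar_scale _ _ (lg' _)) mulN1r alt opprK.
have [v0 v0E] := sphi b0; have [v1 v1E] := sphi b1.
have orth0 z : (exists x y, z = x *: b0 + y *: b1) ->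
    g z b0 = 0 -> g z b1 = 0 -> z = 0.
  move=> [x [y zE]] z0 z1; apply: g0; rewrite {2}zE lg.
  by rewrite (scalar_scale _ _ (lg _)) z0 z1 !mulr0 addr0.
(* The plane is abelian. *)
have e0 : br v0 v1 = 0.
  apply: orth0 => //; last by rewrite -v1E kbr.
  by rewrite -v0E cyc kbr.
have e0' : br v1 v0 = 0 by rewrite abr e0 oppr0.
have [k [l uwE]] := bplane u w.
pose y := k *: v0 + l *: v1.
have yE : phi y = br u w.
  have phi0 : phi 0 = 0.
    by have := lphi (-1) 0 0; rewrite scaler0 addr0 scaleN1r addNr.
  by rewrite uwE /y lphi -[l *: v1]addr0 lphi phi0 addr0 v0E v1E.
(* The plane is even central: pairing [br w y] with [b_i] gives the pairing of
   [br y v_i = 0] with [phi w]. *)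
have wy0 : br w y = 0.
  apply: orth0 => //.
    by rewrite -v0E cyc /y br_lin brr e0' !scaler0 addr0 (scalar_zero (lg' _)).
  by rewrite -v1E cyc /y br_lin brr e0 !scaler0 addr0 (scalar_zero (lg' _)).
by apply: g0; rewrite -{2}yE cyc wy0 (scalar_zero (lg' _)).
Qed.

End Algebra.

Section Span.
Context {R : realType}.

Lemma linear_span_eval (T : Type) (V : lmodType R) (b : 'I_2 -> T -> V)
    (Z : T -> V) (t : T) : linear_span (range b) Z ->
  exists x y, Z t = x *: b ord0 t + y *: b ord_max t.
Proof.
move=> [k [a [f [fb ->]]]]; rewrite fct_sumE.
elim/big_ind: _ => [|_ _ [x [y ->]] [x' [y' ->]]|i _].
- by exists 0, 0; rewrite !scale0r addr0.
- by exists (x + x'), (y + y'); rewrite !scalerDl addrACA.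
have [j _ <-] := fb i; case: (unliftP ord0 j) => [j' ->|->].
  exists 0, (a i); rewrite scale0r add0r !fctE.
  by rewrite (_ : lift ord0 j' = ord_max)//; apply/val_inj; case: j' => -[].
by exists (a i), 0; rewrite scale0r addr0.
Qed.

Lemma has_dimension_nonzero (V : lmodType R) (S : set V) d :
  has_dimension S d.+1 -> exists2 v, S v & v != 0.
Proof.
move=> [b [fb ->]]; exists (b ord0).
  exists 1%N, (fun=> 1), (fun=> b ord0); split; first by move=> _; exists ord0.
  by rewrite big_ord1 scale1r.
apply/eqP => b00; pose a (i : 'I_d.+1) : R := (i == ord0)%:R.
have : \sum_(i < d.+1) a i *: b i = 0.
  rewrite big1// => i _; rewrite /a; case: eqVneq => [->|_].
    by rewrite b00 scaler0.
  by rewrite scale0r.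
by move=> /fb /(_ ord0)/eqP; rewrite /a eqxx oner_eq0.
Qed.

End Span.

Theorem proposition4p3 (R : realType) (n : nat) (G : lieGroupType R n)
    (G_connected : connected [set: G]%classic)
    (dim_commutator : has_dimension (commutator_algebra G) 2) :
  ~ exists g : G -> 'rV[R]_n -> 'rV[R]_n -> R,
      riemannian_metric g /\ bi_invariant g.
Proof.
move=> [g [gm gi]].
have bracket0 X Y : lie_algebra G X -> lie_algebra G Y -> lie_bracket X Y = 0.
  move=> [_ /left_field_eq ->] [_ /left_field_eq ->]; apply/funext => p.
  have [gl gs gp _] := gm.
  have [b [_ DE]] := dim_commutator.
  apply: (skew_bracket_plane_eq0 (phi := fun u => left_field u p)
    (br := fun u w => lie_bracket (left_field u) (left_field w) p) (g := g p)
    (b0 := b ord0 p) (b1 := b ord_max p)) => //.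
  - by move=> a u v; exact: left_field_linear.
  - by move=> v; exact: left_field_surj.
  - by move=> w; exact: lie_bracket_linear_l.
  - by move=> u w; exact: lie_bracket_antisym.
  - exact: gp.
  - by move=> u w; exact: bracket_skew.
  move=> u w; apply: (@linear_span_eval _ _ _ b); rewrite -DE.
  have Lie v : lie_algebra G (left_field v).
    by split; [exact: left_field_smooth|exact: left_field_invariant].
  exists 1%N, (fun=> 1), (fun=> lie_bracket (left_field u) (left_field w)).
  by split; [move=> _; exists (left_field u), (left_field w)
            |rewrite big_ord1 scale1r].
have [Z [k [a [b [bZ ->]]]] /eqP[]] := has_dimension_nonzero dim_commutator.
apply: big1 => i _; have [X [Y [LX LY ->]]] := bZ i.
by rewrite bracket0// scaler0.
Qed.
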